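(* Let ${\bf A}$ be a Hermitian $2\times 2$ matrix with eigenvalues $d_1,d_2$, and let $m\ge1$ be an integer. If $d_1\neq d_2$, then $$\int_{M_2}\mathrm{Tr}\big(({\bf H}^*{\bf A}{\bf H})^m\big)\,d\nu({\bf H})=m!\left((m+1)\frac{d_1^{m+1}-d_2^{m+1}}{d_1-d_2}+\frac{d_1d_2^m-d_2d_1^m}{d_1-d_2}\right).$$ If $d_1=d_2=d$, then $$\int_{M_2}\mathrm{Tr}\big(({\bf H}^*{\bf A}{\bf H})^m\big)\,d\nu({\bf H})=m!\,(m^2+m+2)\,d^m.$$
   Context: $M_2$ denotes the set of $2\times 2$ complex matrices, $d{\bf H}$ Lebesgue measure on $M_2\cong\mathbb{R}^{8}$, and $d\nu({\bf H})=\pi^{-4}\exp(-\mathrm{Tr}({\bf H}^*{\bf H}))\,d{\bf H}$ the Gaussian probability measure. *)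

(* Defs.v *)
From HB Require Import structures.
From mathcomp Require Import all_boot all_order all_algebra.
From mathcomp Require Import all_classical all_reals all_analysis.
From mathcomp Require Import complex.
Set Implicit Arguments. Unset Strict Implicit. Unset Printing Implicit Defensive.
Import Order.TTheory GRing.Theory Num.Theory.
Local Open Scope ring_scope.
Local Open Scope complex_scope.

Definition conjtmx (R : rcfType) (m n : nat) (A : 'M[R[i]]_(m, n)) : 'M[R[i]]_(n, m) :=
  map_mx (@conjc R) A^T.

Definition hermitian_mx (R : rcfType) (n : nat) (A : 'M[R[i]]_n) : Prop :=
  conjtmx A = A.

(* M_2 identified with R^8 via real and imaginary parts of the four entries. *)
Definition R2 (R : realType) := (R * R)%type.
Definition R4 (R : realType) := (R2 R * R2 R)%type.
Definition R8 (R : realType) := (R4 R * R4 R)%type.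

Definition cpx (R : realType) (p : R2 R) : R[i] := p.1 +i* p.2.

Definition mat_of_R8 (R : realType) (x : R8 R) : 'M[R[i]]_2 :=
  \matrix_(j < 2, k < 2)
    if j == 0 then (if k == 0 then cpx x.1.1 else cpx x.1.2)
    else (if k == 0 then cpx x.2.1 else cpx x.2.2).

Definition leb2 (R : realType) := ((@lebesgue_measure.lebesgue_measure R) \x (@lebesgue_measure.lebesgue_measure R))%E.
Definition leb4 (R : realType) := ((@leb2 R) \x (@leb2 R))%E.
Definition leb8 (R : realType) := ((@leb4 R) \x (@leb4 R))%E.

(* Gaussian density: pi^-4 exp(-Tr(H^* H)) (Tr(H^* H) is real). *)
Definition gauss_density (R : realType) (x : R8 R) : R :=
  pi ^- 4 * expR (- complex.Re (\tr (conjtmx (mat_of_R8 x) *m mat_of_R8 x))).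

Definition trace_power (R : realType) (A : 'M[R[i]]_2) (m : nat) (x : R8 R) : R[i] :=
  let H := mat_of_R8 x in \tr ((conjtmx H *m A *m H) ^+ m).

(* Main.v *)
Require Import Defs.
From HB Require Import structures.
From mathcomp Require Import all_boot all_order all_algebra.
From mathcomp Require Import all_classical all_reals all_analysis.
From mathcomp Require Import measurable_realfun.
From mathcomp Require Import complex ring lra.
Set Implicit Arguments. Unset Strict Implicit. Unset Printing Implicit Defensive.
Import Order.TTheory GRing.Theory Num.Theory.
Local Open Scope ring_scope.
Local Open Scope complex_scope.

(** A 2x2 matrix [B] with eigenvalues [a], [b] satisfies
    [Tr B^m = h_m(B) - det B * h_(m-2)(B)], where [h_m(B) = \sum_j a^j b^(m-j)] is
    the trace of the symmetric power [Sym^m B].  As [Sym^m] is multiplicative,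
    [h_m(H^* A H) = Tr (Sym^m A * Sym^m (H H^* ))], and everything reduces to
    [E[Sym^m (H H^* )] = (m+1)! I] and [E[|det H|^2 Sym^m (H H^* )] = (m+2)! I].

    For [H = (x, y; z, w)] the [j]-th row of [Sym^m (H H^* )] consists of the
    coefficients of [(x a + y b)^j (z a + w b)^(m-j)], with [a = conj(x) X + conj(z)]
    and [b = conj(y) X + conj(w)].  Expanding with [E[z^p conj(z)^q] = p!] if [p = q]
    and [0] otherwise, the sums collapse by Vandermonde's identity.  The complex
    moments follow from Gaussian integration by parts,
    [E[z P] = E[dP / d conj(z)]] for polynomials [P] in [z] and [conj(z)]. *)

(** * Symmetric powers of 2x2 matrices *)

Section SymPow.
Variable K : comNzRingType.
Implicit Types (u v : K) (p L : {poly K}) (M N : 'M[K]_2).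

Definition lin u v : {poly K} := u *: 'X + v%:P.

Lemma coef_linM u v p k :
  (lin u v * p)`_k = u * (if k == 0%N then 0 else p`_k.-1) + v * p`_k.
Proof. by rewrite mulrDl -scalerAl coefD coefZ coefXM mul_polyC coefZ. Qed.

(* The degree m homogenisation of p, evaluated at (L1, L2). *)
Definition homog m p L1 L2 := \sum_(k < m.+1) p`_k *: (L1 ^+ k * L2 ^+ (m - k)).

Lemma homog_linM m u v p L1 L2 : (size p <= m.+1)%N ->
  homog m.+1 (lin u v * p) L1 L2 = (u *: L1 + v *: L2) * homog m p L1 L2.
Proof.
move=> sp; rewrite /homog.
under eq_bigr do rewrite coef_linM scalerDl.
rewrite big_split /= mulrDl !mulr_sumr; congr (_ + _).
  rewrite big_ord_recl /= mulr0 scale0r add0r; apply: eq_bigr => k _.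
  by rewrite /bump /= !add1n /= subSS exprS -!scalerAl -!scalerAr scalerA -!mulrA.
(* The size bound on [p] makes its coefficient of index [m.+1] zero, so multiplication by [v]
   contributes no extra top term. *)
rewrite big_ord_recr /= (nth_default _ sp) mulr0 scale0r addr0.
apply: eq_bigr => k _; rewrite subSn; last by rewrite -ltnS.
by rewrite exprS -!scalerAl -!scalerAr scalerA; congr (_ *: _); rewrite mulrCA.
Qed.

Lemma size_linM m u v p : (size p <= m)%N -> (size (lin u v * p)%R <= m.+1)%N.
Proof.
move=> sp; apply: leq_trans (size_polyMleq _ _) _.
have sl : (size (lin u v) <= 2)%N.
  apply: leq_trans (size_polyD _ _) _; rewrite geq_max.
  rewrite (leq_trans (size_scale_leq _ _)) ?size_polyX //.
  by rewrite (leq_trans (size_polyC_leq1 _)).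
by rewrite -subn1 leq_subLR add1n; apply: leq_trans (leq_add sl sp) _.
Qed.

Lemma size_linX u v u' v' j l :
  (size (lin u v ^+ j * lin u' v' ^+ l)%R <= (j + l).+1)%N.
Proof.
elim: j => [|j IH]; last by rewrite exprS -mulrA addSn size_linM.
rewrite mul1r; elim: l => [|l IH]; first by rewrite size_poly1.
by rewrite exprS size_linM.
Qed.

(** Homogenisation in a fixed degree lets linear factors be peeled off one at a time by
    [homog_linM]. This substitution rule for products of linear forms is what makes [sympow]
    multiplicative. *)
Lemma homog_linX u v u' v' j l L1 L2 :
  homog (j + l) (lin u v ^+ j * lin u' v' ^+ l) L1 L2 =
  (u *: L1 + v *: L2) ^+ j * (u' *: L1 + v' *: L2) ^+ l.
Proof.
elim: j => [|j IH]; last first.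
  by rewrite !exprS -!mulrA addSn homog_linM ?IH // size_linX.
elim: l => [|l IH].
  by rewrite /homog big_ord1 /= !expr0 !mulr1 coef1 scale1r.
have := size_linX u v u' v' 0 l; rewrite !expr0 !mul1r !add0n in IH * => sl.
by rewrite !exprS homog_linM ?IH.
Qed.

(* The m-th symmetric power, in the basis X^j Y^(m-j) dehomogenised at Y = 1. *)
Definition sympow m M : 'M[K]_m.+1 :=
  \matrix_(j, k) (lin (M 0 0) (M 0 1) ^+ j * lin (M 1 0) (M 1 1) ^+ (m - j))`_k.

Lemma lin_row_mulmx M N i : lin ((M *m N) i 0) ((M *m N) i 1) =
  M i 0 *: lin (N 0 0) (N 0 1) + M i 1 *: lin (N 1 0) (N 1 1).
Proof.
rewrite !mxE !big_ord_recl !big_ord0 /lin !addr0 /= !scalerDr !scalerA.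
rewrite (_ : lift _ _ = 1); last exact: val_inj.
by rewrite scalerDl !polyCD !polyCM -!mul_polyC; ring.
Qed.

Lemma sympowM m M N : sympow m (M *m N) = sympow m M *m sympow m N.
Proof.
apply/matrixP => j k; rewrite mxE [RHS]mxE !lin_row_mulmx -homog_linX subnKC -1?ltnS //.
by rewrite /homog coef_sum; apply: eq_bigr => i _; rewrite coefZ !mxE.
Qed.

Lemma sympow1 m : sympow m 1%:M = 1%:M.
Proof.
apply/matrixP => j k; rewrite !mxE /lin /=.
by rewrite scale1r scale0r addr0 add0r expr1n mulr1 coefXn eq_sym.
Qed.

(** The first linear form is then a multiple of ['X], so the diagonal entry of row [j] is a power of
    [M 0 0] times the constant term of the second factor. *)
Lemma tr_sympow_trig m M : M 0 1 = 0 ->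
  \tr (sympow m M) = \sum_(j < m.+1) M 0 0 ^+ j * M 1 1 ^+ (m - j).
Proof.
move=> M0; apply: eq_bigr => j _; rewrite mxE M0 /lin addr0 exprZn -scalerAl coefZ.
rewrite coefXnM ltnn subnn -horner_coef0 horner_exp.
by rewrite hornerD hornerZ hornerX hornerC mulr0 add0r.
Qed.

End SymPow.

(** * Power sums and complete symmetric functions of the eigenvalues *)

Section Trigonalisation.
Variable C : numClosedFieldType.
Implicit Types M : 'M[C]_2.

(** By Schur's theorem [M] is unitarily similar to a lower triangular [T], whose diagonal entries
    serve as [a] and [b]. Multiplicativity of [sympow] carries the similarity over to symmetric
    powers. *)
Lemma mx2_eigenvalues M : exists a b,
  [/\ \tr M = a + b, \det M = a * b, forall m, \tr (M ^+ m) = a ^+ m + b ^+ m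
    & forall m, \tr (sympow m M) = \sum_(j < m.+1) a ^+ j * b ^+ (m - j)].
Proof.
have [P uP] := @Schur C 2 M isT; rewrite -[X in is_true X]/(is_trig_mx (conjmx P M)) conjymx // => tM.
set Q := (X in P *m M *m X) in tM; set T := P *m M *m Q in tM.
have uPi : P *m Q = 1%:M by exact/eqP.
have uPi' : Q *m P = 1%:M by exact: mulmx1C.
have ME : M = Q *m T *m P by rewrite /T !mulmxA uPi' mul1mx -mulmxA uPi' mulmx1.
clearbody T.
have T01 : T 0 1 = 0 by move/is_trig_mxP: tM; apply.
have MX m : M ^+ m = Q *m (T ^+ m) *m P.
  elim: m => [|m IH]; first by rewrite !expr0 mulmx1 uPi'.
  rewrite !exprS IH [in LHS]ME -!mulmxE !mulmxA.
  by rewrite -(mulmxA (Q *m T)) uPi mulmx1.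
have TX m : [/\ (T ^+ m) 0 1 = 0, (T ^+ m) 0 0 = T 0 0 ^+ m & (T ^+ m) 1 1 = T 1 1 ^+ m].
  elim: m => [|m [IH0 IH1 IH2]]; first by rewrite !expr0 !mxE.
  rewrite !exprS -mulmxE !mxE !big_ord_recl !big_ord0.
  rewrite (_ : lift _ _ = 1); last exact: val_inj.
  by rewrite IH0 IH1 IH2 T01 !(mulr0, mul0r, addr0, add0r).
have trP (k : nat) (X S S' : 'M[C]_k) : S *m S' = 1%:M -> \tr (S' *m X *m S) = \tr X.
  by move=> QQ; rewrite mxtrace_mulC mulmxA QQ mul1mx.
have tr2 (X : 'M[C]_2) : \tr X = X 0 0 + X 1 1.
  rewrite /mxtrace !big_ord_recl big_ord0 addr0.
  by rewrite (_ : lift _ _ = 1) //; exact: val_inj.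
exists (T 0 0), (T 1 1); split.
- by rewrite ME trP.
- rewrite ME !det_mulmx mulrC mulrA -det_mulmx uPi det1 mul1r.
  rewrite (det_trig tM) !big_ord_recl big_ord0 mulr1.
  by rewrite (_ : lift _ _ = 1) //; exact: val_inj.
- by move=> m; have [_ <- <-] := TX m; rewrite MX trP.
- move=> m; rewrite ME !sympowM trP ?tr_sympow_trig //.
  by rewrite -sympowM uPi sympow1.
Qed.

Lemma tr_expr2_sympow M m :
  \tr (M ^+ m.+2) = \tr (sympow m.+2 M) - \det M * \tr (sympow m M).
Proof.
have [a [b [_ -> -> h]]] := mx2_eigenvalues M; rewrite !h mulr_sumr.
rewrite big_ord_recl big_ord_recr /= subn0 subnn mul1r mulr1.
set s := \sum_(i < m.+1) _; set s' := \sum_(i < m.+1) _.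
(* The extreme terms of [h_(m+2)] are the two pure powers; the middle ones form [a * b] times
   [h_m]. *)
suff -> : s = s' by ring.
apply: eq_bigr => i _; rewrite /bump /= add1n exprS subSS.
by rewrite subSn ?exprS; [ring | rewrite -ltnS].
Qed.

(** Trace and determinant fix the eigenvalues only up to order: [d1] is a root of [(t - a)(t - b)],
    so it equals [a] or [b]. In the second case the sum is read backwards. *)
Lemma tr_sympow_char_poly M d1 d2 m :
  char_poly M = ('X - d1%:P) * ('X - d2%:P) ->
  [/\ \det M = d1 * d2 & \tr (sympow m M) = \sum_(j < m.+1) d1 ^+ j * d2 ^+ (m - j)].
Proof.
move=> cM; have [a [b [tM dM _ h]]] := mx2_eigenvalues M.
have e2 : \det M = d1 * d2.
  have := char_poly_det M; rewrite cM => /esym; rewrite -signr_odd mul1r => ->.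
  by rewrite -horner_coef0 !hornerE; ring.
have e1 : \tr M = d1 + d2.
  have := char_poly_trace M isT; rewrite cM => /esym/eqP.
  rewrite eqr_oppLR => /eqP ->.
  rewrite mulrBl coefB coefXM /= mul_polyC coefZ !coefB !coefX !coefC /=; ring.
split=> //; rewrite h; have : (d1 - a) * (d1 - b) = 0.
  have -> : (d1 - a) * (d1 - b) = d1 ^+ 2 - d1 * (a + b) + a * b by ring.
  by rewrite -tM -dM e1 e2; ring.
move: e1 e2; rewrite tM dM => e1 e2 /eqP; rewrite mulf_eq0 !subr_eq0 => /orP[] /eqP ea.
  by rewrite ea in e1 *; rewrite (addrI _ e1).
rewrite ea [in LHS]addrC in e1 *; rewrite (addrI _ e1) (reindex_inj rev_ord_inj) /=.
by apply: eq_bigr => i _; rewrite subSS subKn 1?mulrC // -ltnS.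
Qed.

End Trigonalisation.

(** * Wick sums *)

Section BinomialSums.
Implicit Types (g : nat -> nat).

(** Pascal's rule moved onto [g], so that Vandermonde's identity can be proved by induction on [j]
    for all [g] at once. *)
Lemma bin_sumS j g :
  (\sum_(p < j.+2) 'C(j.+1, p) * g p = \sum_(p < j.+1) 'C(j, p) * (g p + g p.+1))%N.
Proof.
rewrite big_ord_recl /= bin0 mul1n.
under eq_bigr do rewrite /bump /= add1n binS mulnDl.
under [RHS]eq_bigr do rewrite mulnDr.
rewrite !big_split /= addnA; congr (_ + _)%N.
by rewrite big_ord_recr /= bin_small // mul0n addn0 [RHS]big_ord_recl /= bin0 mul1n.
Qed.

Lemma Vandermonde_sum j l g :
  (\sum_(p < j.+1) \sum_(q < l.+1) 'C(j, p) * 'C(l, q) * g (p + q) =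
   \sum_(r < (j + l).+1) 'C(j + l, r) * g r)%N.
Proof.
transitivity (\sum_(p < j.+1) 'C(j, p) * \sum_(q < l.+1) 'C(l, q) * g (p + q))%N.
  by apply: eq_bigr => p _; rewrite big_distrr /=; apply: eq_bigr => q _; rewrite mulnA.
elim: j g => [|j IH] g; first by rewrite big_ord1 /= bin0 mul1n.
rewrite (bin_sumS j (fun p => \sum_(q < l.+1) 'C(l, q) * g (p + q)))%N.
rewrite addSn bin_sumS -(IH (fun r => g r + g r.+1))%N.
apply: eq_bigr => p _; rewrite -big_split; congr (_ * _)%N.
by apply: eq_bigr => q _; rewrite mulnDr addSn.
Qed.

(** The summand depends on [p + q] only, so Vandermonde leaves a single sum of [j + l + 1] terms,
    each equal to [(j + l)!]. *)
Lemma bin_fact_sum j l :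
  (\sum_(p < j.+1) \sum_(q < l.+1)
      'C(j, p) * 'C(l, q) * ((p + q)`! * ((j - p) + (l - q))`!) = (j + l).+1`!)%N.
Proof.
transitivity (\sum_(p < j.+1) \sum_(q < l.+1)
    'C(j, p) * 'C(l, q) * (fun r => r`! * (j + l - r)`!) (p + q))%N.
  apply: eq_bigr => p _; apply: eq_bigr => q _.
  have [pj ql] : (p <= j)%N /\ (q <= l)%N by split; rewrite -ltnS.
  by rewrite addnBA // addnBAC // -subnDA.
rewrite (Vandermonde_sum j l (fun r => r`! * (j + l - r)`!))%N.
under eq_bigr => r _ do rewrite bin_fact -1?ltnS //.
by rewrite sum_nat_const card_ord factS.
Qed.

End BinomialSums.

Section Wick.
Variable C : comNzRingType.

(* The Gaussian moment E[z^a conj(z)^b]. *)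
Definition wick (a b : nat) : C := (a == b)%:R * a`!%:R.

(* The expectation of x^al z^be conj(x)^e conj(z)^f (conj(x) 'X + conj(z))^r for
   independent Gaussians x and z. *)
Definition wickp (r al be e f : nat) : {poly C} :=
  \sum_(i < r.+1) ('C(r, i)%:R * (wick al (e + i) * wick be (f + (r - i)))) *: 'X^i.

(** The condition [al = e + i] selects at most one index, so the sum collapses to a monomial. *)
Lemma wickp_pick r al be e f i : (i <= r)%N -> al = (e + i)%N -> be = (f + (r - i))%N ->
  wickp r al be e f = ('C(r, i) * (al`! * be`!))%:R *: 'X^i.
Proof.
move=> ir -> ->; rewrite /wickp (bigD1 (Ordinal (n:=r.+1) ir)) //= big1 => [|k nk].
  by rewrite addr0 /wick !eqxx !mul1r !natrM.
rewrite /wick eqn_add2l (_ : (i == k) = false) ?mul0r ?mulr0 ?scale0r //.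
by apply/negbTE; apply: contra nk => /eqP ik; apply/eqP/val_inj.
Qed.

Lemma wickp_eq0 r al be e f :
  (forall i, (i <= r)%N -> al = (e + i)%N -> be <> (f + (r - i))%N) ->
  wickp r al be e f = 0.
Proof.
move=> h; rewrite /wickp big1 // => i _; rewrite /wick.
have [ea|] := eqVneq al; last by rewrite mul0r mul0r mulr0 scale0r.
have [eb|] := eqVneq be; last by rewrite mul0r !mulr0 scale0r.
by have := h i _ ea eb; rewrite -ltnS => /(_ (ltn_ord i)).
Qed.

Lemma bin_factD p q : ('C(p + q, p) * (p`! * q`!) = (p + q)`!)%N.
Proof. by rewrite -{2}(addKn p q) bin_fact ?leq_addr. Qed.

Lemma wickp00 p q : wickp (p + q) p q 0 0 = (p + q)`!%:R *: 'X^p.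
Proof.
rewrite (@wickp_pick _ _ _ _ _ p) ?leq_addr ?addKn //.
by rewrite bin_factD.
Qed.

Lemma wickp10 p q : wickp (p + q) p.+1 q 1 0 = ((p + q)`! * p.+1)%:R *: 'X^p.
Proof.
rewrite (@wickp_pick _ _ _ _ _ p) ?leq_addr ?addKn //.
by rewrite factS -mulnA mulnCA bin_factD mulnC.
Qed.

Lemma wickp01 p q : wickp (p + q) p q.+1 0 1 = ((p + q)`! * q.+1)%:R *: 'X^p.
Proof.
rewrite (@wickp_pick _ _ _ _ _ p) ?leq_addr ?addKn //.
by rewrite factS (mulnCA p`!) mulnCA bin_factD mulnC.
Qed.

(** The extra power sits on [x] and the extra conjugate on [z], so the selected index moves to
    [p.+1]. For [q = 0] no index qualifies, which the factor [q] records; [wickp10S] is the mirror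
    case. *)
Lemma wickp01S p q : wickp (p + q) p.+1 q 0 1 = ((p + q)`! * q)%:R *: 'X^(p.+1).
Proof.
case: q => [|q].
  by rewrite muln0 scale0r wickp_eq0.
rewrite (@wickp_pick _ _ _ _ _ p.+1) ?addnS ?ltnS ?leq_addr //; last first.
  by rewrite subSS addKn.
by rewrite factS (mulnCA _ q.+1) mulnCA -addSn bin_factD mulnC.
Qed.

Lemma wickp10S p q : wickp (p + q) p q.+1 1 0 = ((p + q)`! * p)%:R *: 'X^(p.-1).
Proof.
case: p => [|p].
  by rewrite muln0 scale0r wickp_eq0.
rewrite (@wickp_pick _ _ _ _ _ p) //=; last 2 first.
- by rewrite addSn leqW // leq_addr.
- by rewrite addSnnS addKn.
by rewrite factS -mulnA mulnCA addSnnS bin_factD mulnC.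
Qed.

(* The four terms come from the monomials of det H * conj(det H). *)
Lemma wick_block p q J L :
  wickp (p + q) p.+1 q 1 0 * wickp (J + L) J L.+1 0 1
  - wickp (p + q) p.+1 q 0 1 * wickp (J + L) J L.+1 1 0
  - wickp (p + q) p q.+1 1 0 * wickp (J + L) J.+1 L 0 1
  + wickp (p + q) p q.+1 0 1 * wickp (J + L) J.+1 L 1 0
  = ((p + q)`! * (J + L)`! * (p + q + J + L).+2)%:R *: 'X^(p + J).
Proof.
rewrite !(wickp10, wickp01, wickp10S, wickp01S) -!scalerAl -!scalerAr !scalerA.
(* The exponents disagree only for [J = 0], where the coefficient vanishes; likewise for [p = 0]
   below. *)
have -> : (((p + q)`! * q)%:R * ((J + L)`! * J)%:R) *: ('X^(p.+1) * 'X^(J.-1)) =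
    (((p + q)`! * q)%:R * ((J + L)`! * J)%:R) *: 'X^(p + J) :> {poly C}.
  case: J => [|J]; first by rewrite muln0 mulr0 !scale0r.
  by rewrite /= -exprD (addSnnS p J).
have -> : (((p + q)`! * p)%:R * ((J + L)`! * L)%:R) *: ('X^(p.-1) * 'X^(J.+1)) =
    (((p + q)`! * p)%:R * ((J + L)`! * L)%:R) *: 'X^(p + J) :> {poly C}.
  case: p => [|p]; first by rewrite muln0 mul0r !scale0r.
  by rewrite /= -exprD (addSnnS p J).
rewrite -!exprD -!scalerBl -scalerDl; congr (_ *: _).
(* The identity is [(p+1)(L+1) - qJ - pL + (q+1)(J+1) = p+q+J+L+2]. *)
rewrite !natrM -!natr1 !natrD; ring.
Qed.

End Wick.

Lemma det_mx2 (C : comNzRingType) (M : 'M[C]_2) :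
  \det M = M 0 0 * M 1 1 - M 0 1 * M 1 0.
Proof.
have l0 : lift ord0 ord0 = 1 :> 'I_2 by exact: val_inj.
have l1 : lift 1 ord0 = 0 :> 'I_2 by exact: val_inj.
rewrite (expand_det_row _ 0) big_ord_recl big_ord1 /cofactor !det_mx11 !mxE l0 l1.
by rewrite expr0 expr1 mul1r mulN1r mulrN.
Qed.

(** * Symmetric powers of a matrix with independent complex Gaussian entries *)

Section Expectation.
Variables (T : Type) (C : comNzRingType).

(* [E f v] reads "f is integrable, with expectation v". *)
Record linear_expectation (E : (T -> C) -> C -> Prop) : Prop := LinearExpectation {
  expect_ext : forall f g v, (forall t, f t = g t) -> E f v -> E g v;
  expect_lin : forall a f g u v, E f u -> E g v -> E (fun t => a * f t + g t) (a * u + v);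
  expect0 : E (fun=> 0) 0 }.

Variables (E : (T -> C) -> C -> Prop) (linE : linear_expectation E).
(* K stands for the conjugate transpose of H. *)
Variables (H K : T -> 'M[C]_2).
Hypothesis momentE : forall a a' b b' c c' d d',
  E (fun t => (H t 0 0 ^+ a * K t 0 0 ^+ a') * (H t 0 1 ^+ b * K t 1 0 ^+ b') *
              (H t 1 0 ^+ c * K t 0 1 ^+ c') * (H t 1 1 ^+ d * K t 1 1 ^+ d'))
    (wick C a a' * wick C b b' * wick C c c' * wick C d d').

Definition pexpect (F : T -> {poly C}) (P : {poly C}) := forall k, E (fun t => (F t)`_k) P`_k.

Lemma expectZ a f v : E f v -> E (fun t => a * f t) (a * v).
Proof.
move=> /(expect_lin linE a) /(_ (expect0 linE)); rewrite addr0.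
by apply: expect_ext => // t; rewrite addr0.
Qed.

Lemma expectD f g u v : E f u -> E g v -> E (fun t => f t + g t) (u + v).
Proof.
move=> fu gv; have := expect_lin linE 1 fu gv; rewrite mul1r.
by apply: expect_ext => // t; rewrite mul1r.
Qed.

Lemma expect_sum n (f : 'I_n -> T -> C) v :
  (forall i, E (f i) (v i)) -> E (fun t => \sum_i f i t) (\sum_i v i).
Proof.
elim: n f v => [|n IH] f v h.
  rewrite big_ord0; apply: expect_ext (expect0 linE) => // t; by rewrite big_ord0.
rewrite big_ord_recl.
apply: expect_ext (expectD (h ord0) (IH _ _ (fun i => h (lift ord0 i)))) => // t.
by rewrite big_ord_recl.
Qed.

Lemma pexpect_ext F G P : (forall t, F t = G t) -> pexpect F P -> pexpect G P.
Proof. by move=> FG FP k; apply: expect_ext (FP k) => // t; rewrite FG. Qed.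

Lemma pexpect_lin a F G P Q : pexpect F P -> pexpect G Q ->
  pexpect (fun t => a *: F t + G t) (a *: P + Q).
Proof.
move=> FP GQ k; rewrite coefD coefZ.
by apply: expect_ext (expect_lin linE a (FP k) (GQ k)) => // t; rewrite coefD coefZ.
Qed.

Lemma pexpectZ a F P : pexpect F P -> pexpect (fun t => a *: F t) (a *: P).
Proof.
move=> FP k; rewrite coefZ.
by apply: expect_ext (expectZ a (FP k)) => // t; rewrite coefZ.
Qed.

Lemma pexpect_sum n (F : 'I_n -> T -> {poly C}) P :
  (forall i, pexpect (F i) (P i)) -> pexpect (fun t => \sum_i F i t) (\sum_i P i).
Proof.
move=> FP k; rewrite coef_sum.
by apply: expect_ext (expect_sum (fun i => FP i k)) => // t; rewrite coef_sum.
Qed.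

Lemma pexpect_mon f v P : E f v -> pexpect (fun t => f t *: P) (v *: P).
Proof.
move=> fv k; rewrite coefZ mulrC.
by apply: expect_ext (expectZ P`_k fv) => // t; rewrite coefZ mulrC.
Qed.

Lemma lin_exp (u v : C) r :
  lin u v ^+ r = \sum_(i < r.+1) ('C(r, i)%:R * (u ^+ i * v ^+ (r - i))) *: 'X^i.
Proof.
rewrite /lin addrC exprDn; apply: eq_bigr => i _.
rewrite exprZn -rmorphXn /= mul_polyC -scaler_nat !scalerA; congr (_ *: _).
by ring.
Qed.

(** The first linear form involves only conjugates from the first column of [H], the second only
    those from the second column. By independence of the columns the expectation splits into two
    [wickp] factors. *)
Lemma pexpect_block al be ga de e f g h r s :
  pexpect (fun t => (H t 0 0 ^+ al * H t 0 1 ^+ ga * H t 1 0 ^+ be * H t 1 1 ^+ de *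
                     (K t 0 0 ^+ e * K t 1 0 ^+ g * K t 0 1 ^+ f * K t 1 1 ^+ h)) *:
                    (lin (K t 0 0) (K t 0 1) ^+ r * lin (K t 1 0) (K t 1 1) ^+ s))
    (wickp C r al be e f * wickp C s ga de g h).
Proof.
pose c i j : C := 'C(r, i)%:R * 'C(s, j)%:R.
pose F i j := fun t =>
  (H t 0 0 ^+ al * K t 0 0 ^+ (e + i)) * (H t 0 1 ^+ ga * K t 1 0 ^+ (g + j)) *
  (H t 1 0 ^+ be * K t 0 1 ^+ (f + (r - i))) *
  (H t 1 1 ^+ de * K t 1 1 ^+ (h + (s - j))).
have FE : pexpect
    (fun t => \sum_(i < r.+1) \sum_(j < s.+1) c i j *: (F i j t *: 'X^(i + j)))
    (\sum_(i < r.+1) \sum_(j < s.+1) c i j *: ((wick C al (e + i) * wick C ga (g + j) *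
       wick C be (f + (r - i)) * wick C de (h + (s - j))) *: 'X^(i + j))).
  by do 2!(apply: pexpect_sum => ?); apply/pexpectZ/pexpect_mon/momentE.
set P := (X in pexpect _ X) in FE; suff -> : wickp C r al be e f * wickp C s ga de g h = P.
  apply: pexpect_ext FE => t; rewrite !lin_exp mulr_suml scaler_sumr.
  apply: eq_bigr => i _; rewrite mulr_sumr scaler_sumr; apply: eq_bigr => j _.
  rewrite -scalerAl -scalerAr !scalerA -exprD; congr (_ *: _).
  by rewrite /c /F !exprD; ring.
rewrite /wickp mulr_suml; apply: eq_bigr => i _; rewrite mulr_sumr.
apply: eq_bigr => j _; rewrite -scalerAl -scalerAr !scalerA -exprD; congr (_ *: _).
by rewrite /c; ring.
Qed.

Lemma pow_lin2 (x y : C) (a b : {poly C}) n :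
  (x *: a + y *: b) ^+ n =
  \sum_(p < n.+1) ('C(n, p)%:R * (x ^+ p * y ^+ (n - p))) *: (a ^+ p * b ^+ (n - p)).
Proof.
rewrite addrC exprDn; apply: eq_bigr => p _.
rewrite !exprZn -scalerAl -scalerAr scalerA -scaler_nat !scalerA [b ^+ _ * _]mulrC.
by congr (_ *: _); ring.
Qed.

(** The generating polynomial of row [j] of [sympow (j + l) (H t *m K t)]; using [l] for [m - j]
    keeps truncated subtraction out of the expansion. *)
Let hrow j l t : {poly C} :=
  (H t 0 0 *: lin (K t 0 0) (K t 0 1) + H t 0 1 *: lin (K t 1 0) (K t 1 1)) ^+ j *
  (H t 1 0 *: lin (K t 0 0) (K t 0 1) + H t 1 1 *: lin (K t 1 0) (K t 1 1)) ^+ l.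

Lemma row_expand j l t : hrow j l t =
  \sum_(p < j.+1) \sum_(q < l.+1) ('C(j, p) * 'C(l, q))%:R *:
   ((H t 0 0 ^+ p * H t 0 1 ^+ (j - p) * H t 1 0 ^+ q * H t 1 1 ^+ (l - q)) *:
    (lin (K t 0 0) (K t 0 1) ^+ (p + q) * lin (K t 1 0) (K t 1 1) ^+ ((j - p) + (l - q)))).
Proof.
rewrite /hrow !pow_lin2 mulr_suml; apply: eq_bigr => p _.
rewrite mulr_sumr; apply: eq_bigr => q _.
rewrite -scalerAl -scalerAr !scalerA natrM !exprD.
set a := lin _ _; set b := lin _ _.
by congr (_ *: _); ring.
Qed.

Lemma sympow_row m t (j : 'I_m.+1) k :
  sympow m (H t *m K t) j k = (hrow j (m - j) t)`_k.
Proof. by rewrite mxE /hrow !lin_row_mulmx.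
Qed.

(** Each pair [(p, q)] of the expansion yields a multiple of ['X^p * 'X^(j - p)], hence only the
    diagonal coefficient survives; [bin_fact_sum] adds up the multiples. *)
Lemma pexpect_row j l : pexpect (hrow j l) ((j + l).+1`!%:R *: 'X^j).
Proof.
have -> : ((j + l).+1`!%:R *: 'X^j : {poly C}) =
    \sum_(p < j.+1) \sum_(q < l.+1) ('C(j, p) * 'C(l, q))%:R *:
      (wickp C (p + q) p q 0 0 * wickp C ((j - p) + (l - q)) (j - p) (l - q) 0 0).
  rewrite -bin_fact_sum natr_sum scaler_suml; apply: eq_bigr => p _.
  rewrite natr_sum scaler_suml; apply: eq_bigr => q _.
  rewrite !wickp00 -scalerAl -scalerAr -exprD subnKC -1?ltnS // !scalerA.
  by rewrite -!natrM !mulnA.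
apply: pexpect_ext (fun t => esym (row_expand j l t)) _.
do 2!(apply: pexpect_sum => ?); apply: pexpectZ.
by apply: pexpect_ext (pexpect_block _ _ _ _ 0 0 0 0 _ _) => t; rewrite !expr0 !mulr1.
Qed.

(** The determinants split every term [(p, q)] into four, which [wick_block] recombines with
    [J = j - p] and [L = l - q]. The factor [j + l + 2] that appears is the same for all terms, so
    the sum of [pexpect_row] remains. *)
Lemma pexpect_det_row j l :
  pexpect (fun t => (\det (H t) * \det (K t)) *: hrow j l t) ((j + l).+2`!%:R *: 'X^j).
Proof.
pose B r s al be ga de e f g h := wickp C r al be e f * wickp C s ga de g h.
have -> : ((j + l).+2`!%:R *: 'X^j : {poly C}) =
    \sum_(p < j.+1) \sum_(q < l.+1) ('C(j, p) * 'C(l, q))%:R *: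
     (let r := (p + q)%N in let s := (j - p + (l - q))%N in
      B r s p.+1 q (j - p)%N (l - q).+1 1%N 0%N 0%N 1%N
      + ((-1) *: B r s p.+1 q (j - p)%N (l - q).+1 0%N 1%N 1%N 0%N
      + ((-1) *: B r s p q.+1 (j - p).+1 (l - q)%N 1%N 0%N 0%N 1%N
      + B r s p q.+1 (j - p).+1 (l - q)%N 0%N 1%N 1%N 0%N))).
  rewrite factS natrM -bin_fact_sum natr_sum mulr_sumr scaler_suml.
  apply: eq_bigr => p _; rewrite natr_sum mulr_sumr scaler_suml; apply: eq_bigr => q _.
  cbv zeta; rewrite !scaleN1r !addrA wick_block.
  have [pj ql] : (p <= j)%N /\ (q <= l)%N by split; rewrite -ltnS.
  rewrite subnKC // -addnA addnACA subnKC // subnKC // scalerA -!natrM.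
  by congr (_%:R *: _); rewrite [LHS]mulnC !mulnA.
have row2 t : (\det (H t) * \det (K t)) *: hrow j l t =
   \sum_(p < j.+1) \sum_(q < l.+1) ('C(j, p) * 'C(l, q))%:R *:
   ((H t 0 0 ^+ p * H t 0 1 ^+ (j - p) * H t 1 0 ^+ q * H t 1 1 ^+ (l - q) *
     (\det (H t) * \det (K t))) *:
    (lin (K t 0 0) (K t 0 1) ^+ (p + q) * lin (K t 1 0) (K t 1 1) ^+ ((j - p) + (l - q)))).
  rewrite row_expand scaler_sumr; apply: eq_bigr => p _.
  rewrite scaler_sumr; apply: eq_bigr => q _; rewrite !scalerA; congr (_ *: _).
  by ring.
apply: pexpect_ext (fun t => esym (row2 t)) _.
do 2!(apply: pexpect_sum => ?); apply: pexpectZ.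
set r := (_ + _)%N; set s := (_ + _)%N => /=.
pose b al be ga de e f g h := @pexpect_block al be ga de e f g h r s.
have b2 F P G Q : pexpect F P -> pexpect G Q -> pexpect (fun t => F t + G t) (P + Q).
  move=> FP GQ; have := pexpect_lin 1 FP GQ; rewrite scale1r.
  by apply: pexpect_ext => t; rewrite scale1r.
apply: pexpect_ext (b2 _ _ _ _ (b _ _ _ _ _ _ _ _) (pexpect_lin (-1)
  (b _ _ _ _ _ _ _ _) (pexpect_lin (-1) (b _ _ _ _ _ _ _ _) (b _ _ _ _ _ _ _ _)))).
move=> t; rewrite !scalerA -!scalerDl !det_mx2; congr (_ *: _).
by rewrite !exprS !expr0; ring.
Qed.

(** Cyclicity of the trace separates the fixed matrix [A] from the random product [B *m D]. *)
Lemma tr_sympow_conj (A B D : 'M[C]_2) m :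
  \tr (sympow m (D *m A *m B)) =
  \sum_i \sum_j sympow m A i j * sympow m (B *m D) j i.
Proof.
rewrite !sympowM -mulmxA mxtrace_mulC -mulmxA.
by apply: eq_bigr => i _; rewrite mxE.
Qed.

(** Applied with weight 1 and with weight [\det H * \det K]: in both cases the expected symmetric
    power is a scalar matrix, which leaves the trace for [A]. *)
Lemma expect_tr_weight (w : T -> C) c (A : 'M[C]_2) m :
  (forall j k, E (fun t => w t * sympow m (H t *m K t) j k) (c * (j == k)%:R)) ->
  E (fun t => w t * \tr (sympow m (K t *m A *m H t))) (c * \tr (sympow m A)).
Proof.
move=> h; have -> : c * \tr (sympow m A) =
    \sum_i \sum_j sympow m A i j * (c * (j == i)%:R).
  rewrite mulr_sumr; apply: eq_bigr => i _; rewrite (bigD1 i) //= eqxx mulr1 mulrC.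
  rewrite big1 ?addr0 // => j /negbTE ->; by rewrite !mulr0.
have := expect_sum (fun i => expect_sum (fun j => expectZ (sympow m A i j) (h j i))).
apply: expect_ext => // t; rewrite tr_sympow_conj mulr_sumr.
by apply: eq_bigr => i _; rewrite mulr_sumr; apply: eq_bigr => j _; ring.
Qed.

Lemma expect_tr_sympow (A : 'M[C]_2) m :
  E (fun t => \tr (sympow m (K t *m A *m H t))) (m.+1`!%:R * \tr (sympow m A)).
Proof.
have := @expect_tr_weight (fun=> 1) m.+1`!%:R A m.
have h j k : E (fun t => 1 * sympow m (H t *m K t) j k) (m.+1`!%:R * (j == k)%:R).
  have := pexpect_row j (m - j) k; rewrite subnKC -1?ltnS // coefZ coefXn eq_sym.
  by apply: expect_ext => // t; rewrite mul1r sympow_row.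
by move=> /(_ h); apply: expect_ext => // t; rewrite mul1r.
Qed.

Lemma expect_det_tr_sympow (A : 'M[C]_2) m :
  E (fun t => \det (K t *m A *m H t) * \tr (sympow m (K t *m A *m H t)))
    (m.+2`!%:R * (\det A * \tr (sympow m A))).
Proof.
have := @expect_tr_weight (fun t => \det (H t) * \det (K t)) m.+2`!%:R A m.
have h j k : E (fun t => \det (H t) * \det (K t) * sympow m (H t *m K t) j k)
    (m.+2`!%:R * (j == k)%:R).
  have := pexpect_det_row j (m - j) k; rewrite subnKC -1?ltnS // coefZ coefXn eq_sym.
  by apply: expect_ext => // t; rewrite coefZ sympow_row.
move=> /(_ h) /(expectZ (\det A)); rewrite [in X in E _ X]mulrCA.
by apply: expect_ext => // t; rewrite !det_mulmx; ring.
Qed.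

End Expectation.

Lemma expect_tr_exp2 (T : Type) (C : numClosedFieldType) (E : (T -> C) -> C -> Prop)
    (H K : T -> 'M[C]_2) : linear_expectation E ->
  (forall a a' b b' c c' d d',
    E (fun t => (H t 0 0 ^+ a * K t 0 0 ^+ a') * (H t 0 1 ^+ b * K t 1 0 ^+ b') *
                (H t 1 0 ^+ c * K t 0 1 ^+ c') * (H t 1 1 ^+ d * K t 1 1 ^+ d'))
      (wick C a a' * wick C b b' * wick C c c' * wick C d d')) ->
  forall (A : 'M[C]_2) m,
  E (fun t => \tr ((K t *m A *m H t) ^+ m.+2))
    (m.+3`!%:R * \tr (sympow m.+2 A) - m.+2`!%:R * (\det A * \tr (sympow m A))).
Proof.
move=> linE momE A m; rewrite addrC -mulN1r.
apply: expect_ext (expect_lin linE (-1) (expect_det_tr_sympow linE momE A m)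
  (expect_tr_sympow linE momE A m.+2)) => // t.
by rewrite tr_expr2_sympow mulN1r addrC.
Qed.

(** Covers exponent 1, which the recurrence [tr_expr2_sympow] does not reach. *)
Lemma tr_sympow1 (C : numClosedFieldType) (M : 'M[C]_2) : \tr (sympow 1 M) = \tr M.
Proof.
have [a [b [-> _ _ ->]]] := mx2_eigenvalues M.
by rewrite !big_ord_recl big_ord0 /= !expr0 !expr1 mul1r mulr1 addr0 addrC.
Qed.

(** * Gaussian moments *)

Section PolyMoments.
Variables (F : numFieldType) (mom : nat -> F).
Hypothesis momS : forall k, 2 * mom k.+1 = k%:R * mom k.-1.
Implicit Types (p : {poly F}) (P Q : {poly {poly F}}).

(** Formal integration against [exp(-x^2)]: [momS] is integration by parts on monomials. *)
Definition mom1 p : F := \sum_(i < size p) p`_i * mom i.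

Lemma mom1_wide n p : (size p <= n)%N -> mom1 p = \sum_(i < n) p`_i * mom i.
Proof.
move=> sp; rewrite /mom1 (big_ord_widen _ (fun i => p`_i * mom i) sp) big_mkcond.
apply: eq_bigr => i _; case: ltnP => // h; by rewrite nth_default // mul0r.
Qed.

Fact mom1_is_scalar : scalar mom1.
Proof.
move=> a p q; set n := maxn (size p) (size q).
have sn : (size (a *: p + q)%R <= n)%N.
  apply: leq_trans (size_polyD _ _) _.
  by rewrite geq_max leq_maxr (leq_trans (size_scale_leq _ _)) // leq_maxl.
rewrite (mom1_wide sn) (mom1_wide (leq_maxl _ _ : (size p <= n)%N)).
rewrite (mom1_wide (leq_maxr _ _ : (size q <= n)%N)) mulr_sumr -big_split /=.
by apply: eq_bigr => i _; rewrite coefD coefZ mulrDl mulrA.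
Qed.
HB.instance Definition _ := GRing.isLinear.Build F {poly F} F _ mom1 mom1_is_scalar.

Lemma mom1_Xmul p : 2 * mom1 ('X * p) = mom1 p^`().
Proof.
set n := size p.
have sX : (size ('X * p)%R <= n.+1)%N.
  by rewrite (leq_trans (size_polyMleq _ _)) // size_polyX.
have sd : (size p^`() <= n)%N.
  by apply/leq_sizeP => j nj; rewrite coef_deriv nth_default ?mul0rn // leqW.
rewrite (mom1_wide sX) (mom1_wide sd) big_ord_recl coefXM mul0r add0r mulr_sumr.
under eq_bigr => i _ do rewrite /= /bump /= add1n coefXM /= mulrCA momS.
have -> : \sum_(i < n) p`_i * (i%:R * mom i.-1) = \sum_(i < n.+1) p`_i * (i%:R * mom i.-1).
  by rewrite big_ord_recr /= nth_default // mul0r addr0.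
rewrite big_ord_recl mul0r mulr0 add0r; apply: eq_bigr => i _.
by rewrite /= /bump /= add1n coef_deriv mulrA mulr_natr.
Qed.

(* The iterated moment functional; the outer and inner variables stand for the
   two coordinates. *)
Definition mom2 P : F := mom1 (map_poly mom1 P).

Lemma mom2D P Q : mom2 (P + Q) = mom2 P + mom2 Q.
Proof. by rewrite /mom2 raddfD raddfD. Qed.

Lemma mom2C c P : mom2 (c%:P%:P * P) = c * mom2 P.
Proof.
rewrite /mom2 -linearZ /=; congr mom1; apply/polyP => i.
by rewrite coefZ !coef_map /= !mul_polyC coefZ mul_polyC linearZ.
Qed.

Lemma mom2_Xmul P : 2 * mom2 ('X * P) = mom2 P^`().
Proof.
have -> : mom2 ('X * P) = mom1 ('X * map_poly mom1 P).
  by congr mom1; apply/polyP => i; rewrite coef_map /= !coefXM coef_map /=; case: eqP; rewrite ?raddf0.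
rewrite mom1_Xmul; congr mom1; apply/polyP => i.
by rewrite coef_deriv !coef_map /= coef_deriv raddfMn.
Qed.

Lemma mom2_XCmul P : 2 * mom2 ('X%:P * P) = mom2 (map_poly deriv P).
Proof.
rewrite /mom2 -linearZ /=; congr mom1; apply/polyP => i.
by rewrite coefZ !coef_map /= mul_polyC coefZ /= mom1_Xmul.
Qed.

(* [zlin 'i] and [zlin (- 'i)] are z = x + iy and its conjugate. *)
Definition zlin c : {poly {poly F}} := 'X%:P + c%:P%:P * 'X.

(** The derivation d/dx + c d/dy, where x is the inner variable; for [c = 'i] it is twice the
    derivative in the conjugate of z. *)
Definition dlin c P : {poly {poly F}} := map_poly deriv P + c%:P%:P * P^`().

Lemma mom2_zlin c P : 2 * mom2 (zlin c * P) = mom2 (dlin c P).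
Proof.
rewrite /zlin /dlin (mulrDl _ _ P) !mom2D mulrDr mom2_XCmul; congr (_ + _).
by rewrite -mulrA !mom2C mulrCA mom2_Xmul.
Qed.

Lemma dlin_zlin c d P : dlin c (zlin d * P) = zlin d * dlin c P + (1 + c * d)%:P%:P * P.
Proof.
have e1 : map_poly deriv (zlin d * P) = P + zlin d * map_poly deriv P.
  apply/polyP => i; rewrite coef_map /= coefD /zlin !mulrDl !coefD -!mulrA.
  rewrite !mul_polyC !coefZ /= !mul_polyC !coefXM coef_map /=.
  by case: i => [|i] /=; rewrite ?coef_map /= ?scaler0 ?derivD ?derivM ?derivX ?derivZ ?linear0; ring.
have e2 : (zlin d * P)^`() = d%:P%:P * P + zlin d * P^`().
  by rewrite derivM /zlin derivD derivC derivM derivC derivX mul0r add0r mulr1 add0r.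
rewrite /dlin e1 e2 !polyCD !polyCM; ring.
Qed.

Lemma dlin1 c : dlin c 1 = 0.
Proof. by rewrite /dlin derivC mulr0 addr0 -[1]/(1%:P) map_polyC /= derivC. Qed.

(** By the Leibniz rule [dlin_zlin], [dlin c] sends [zlin c] to [1 + c * c = 0] and [zlin d] to
    [1 + c * d = 2]. *)
Lemma dlin_pow c d a b : c * c = -1 -> c * d = 1 ->
  dlin c (zlin c ^+ a * zlin d ^+ b) = (b.*2)%:R * (zlin c ^+ a * zlin d ^+ b.-1).
Proof.
move=> cc cd; elim: a => [|a IH].
  rewrite !mul1r; elim: b => [|b IHb]; first by rewrite dlin1 mul0r.
  rewrite exprS dlin_zlin IHb cd !polyCD -!mul2n !natrM.
  by case: b {IHb} => [|b] /=; rewrite ?exprS -?natr1; ring.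
rewrite exprS -mulrA dlin_zlin IH cc subrr mul0r addr0; ring.
Qed.

(** Integration by parts removes one z and differentiates the conjugate power, giving [b] times the
    moment of exponents [a] and [b - 1]. If one exponent is zero and the other is not, the
    derivative vanishes. *)
Lemma mom2_zlin_pow c a b : c * c = -1 ->
  mom2 (zlin c ^+ a * zlin (- c) ^+ b) = wick F a b * mom 0 ^+ 2.
Proof.
move=> cc; have cd : c * - c = 1 by rewrite mulrN cc opprK.
have two0 : 2 != 0 :> F by rewrite pnatr_eq0.
have mom2N n P : mom2 (n%:R * P) = n%:R * mom2 P.
  by rewrite -mom2C !rmorph_nat.
elim: a b => [|a IH] [|b].
- have m1 x : mom1 x%:P = x * mom 0.
    by rewrite (mom1_wide (size_polyC_leq1 _)) big_ord1 coefC.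
  have -> : zlin c ^+ 0 * zlin (- c) ^+ 0 = 1%:P%:P by rewrite !expr0 mulr1 !polyC1.
  by rewrite /wick !mul1r /mom2 map_polyC /= !m1 mul1r expr2.
- have cc' : - c * - c = -1 by rewrite mulrNN.
  have cd' : - c * c = 1 by rewrite mulNr cc opprK.
  rewrite expr0 mul1r exprS; apply: (mulfI two0); rewrite mom2_zlin.
  have := dlin_pow b 0 cc' cd'; rewrite mulr1 mul0r => ->.
  by rewrite /wick !mul0r mulr0 /mom2 !raddf0.
- rewrite expr0 mulr1 exprS; apply: (mulfI two0); rewrite mom2_zlin.
  have := dlin_pow a 0 cc cd; rewrite mulr1 mul0r => ->.
  by rewrite /wick !mul0r mulr0 /mom2 !raddf0.
rewrite exprS -mulrA; apply: (mulfI two0); rewrite mom2_zlin dlin_pow // mom2N IH /=.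
by rewrite /wick eqSS factS; case: eqP => [->|]; rewrite ?mul0r ?mulr0 // -mul2n !natrM; ring.
Qed.

End PolyMoments.

(** * Integrals of [x^k exp(-x^2)] on the real line *)

Section GaussianMoments.
Import numFieldNormedType.Exports.
Local Open Scope classical_set_scope.
Variable R : realType.
Local Notation mu := (@lebesgue_measure R).
Implicit Types (x : R) (k : nat).

Definition gpow k x : R := x ^+ k * gauss_fun x.

(** With [t = x^2 / 2], the left side is at most [1 + (2t)^k], and [t^k <= k! exp t] by the
    exponential series. Half of the Gaussian exponent thus absorbs any power, and the other half is
    left for integrability. *)
Lemma normr_exp_le x k : `|x| ^+ k <= (1 + 2 ^+ k * k`!%:R) * expR (x ^+ 2 / 2).
Proof.
set t := x ^+ 2 / 2; have t0 : 0 <= t by rewrite divr_ge0 ?sqr_ge0.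
have e1 : 1 <= expR t by rewrite -expR0 ler_expR.
have le1 : `|x| ^+ k <= 1 + (x ^+ 2) ^+ k.
  have [x1|/ltW x1] := leP `|x| 1.
    by apply: ler_wpDr; [rewrite exprn_ge0 ?sqr_ge0 | exact: exprn_ile1].
  apply: ler_wpDl => //; rewrite -real_normK ?num_real // -exprM.
  by rewrite ler_weXn2l // leq_pmull.
apply: le_trans le1 _; rewrite mulrDl mul1r lerD //.
rewrite (_ : x ^+ 2 = 2 * t); last by rewrite /t; field.
rewrite exprMn -mulrA ler_pM2l ?exprn_gt0 // -ler_pdivrMl ?ltr0n ?fact_gt0 //.
case: k => [|k]; first by rewrite fact0 expr0 invr1 mul1r.
by apply: le_trans (expR_ge1Dxn k t0); rewrite mulrC ler_wpDl.
Qed.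

Lemma gpow_le k x : `|gpow k x| <= (1 + 2 ^+ k * k`!%:R) * expR (- (x ^+ 2 / 2)).
Proof.
rewrite /gpow normrM normrX (ger0_norm (gauss_fun_ge0 x)) /gauss_fun.
have -> : - x ^+ 2 = - (x ^+ 2 / 2) + - (x ^+ 2 / 2) by field.
rewrite expRD mulrA ler_pM2r ?expR_gt0 //.
by rewrite expRN ler_pdivrMr ?expR_gt0 // normr_exp_le.
Qed.

Lemma continuous_gpow k : continuous (gpow k).
Proof.
move=> x; apply: cvgM; first exact: exprn_continuous.
exact: continuous_gauss_fun.
Qed.

Lemma measurable_gpow k : measurable_fun setT (gpow k).
Proof. by apply: continuous_measurable_fun; exact: continuous_gpow. Qed.

Lemma integrable_gpow k : mu.-integrable setT (EFin \o gpow k).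
Proof.
have h := integrable_normal_pdf (0 : R) 1.
have p0 : 0 < normal_peak (1 : R) by rewrite normal_peak_gt0.
(* The dominating function [exp(-x^2 / 2)] is the standard normal density divided by its peak. *)
have hi := integrableZl measurableT ((1 + 2 ^+ k * k`!%:R) / normal_peak 1) h.
apply: (@le_integrable _ _ _ mu setT measurableT (EFin \o gpow k) _ _ _ hi).
  by apply/measurable_EFinP; exact: measurable_gpow.
move=> x _ /=; rewrite lee_fin; apply: le_trans (gpow_le k x) _.
apply: le_trans (ler_norm _); rewrite normal_pdfE ?oner_eq0 //.
rewrite mulrA divfK ?gt_eqF // /normal_fun subr0 expr1n.
by rewrite mulNr.
Qed.

Lemma is_derive_gpow k x :
  is_derive x 1 (gpow k) (k%:R * gpow k.-1 x - 2 * gpow k.+1 x).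
Proof.
have dX (p : {poly R}) f : (forall y, f y = p.[y]) -> is_derive x 1 f p^`().[x].
  by move=> fp; rewrite (_ : f = horner p); [exact: is_derive_poly | exact/funext].
have d1 : is_derive x 1 (fun y : R => y ^+ k) ('X^k)^`().[x].
  by apply: dX => y; rewrite hornerXn.
have d2 : is_derive x 1 (fun y : R => - y ^+ 2) (- 'X^2)^`().[x].
  by apply: dX => y; rewrite hornerN hornerXn.
have d3 := @is_derive1_comp _ expR (fun y => - y ^+ 2) x _ _ (is_derive_expR _) d2.
have e1 : ('X^k)^`().[x] = k%:R * x ^+ k.-1.
  by rewrite derivXn hornerMn hornerXn mulr_natl.
have e2 : (- 'X^2)^`().[x] = - (2 * x).
  by rewrite derivN derivXn hornerN hornerMn hornerXn mulr_natl.
apply: is_derive_eq (is_deriveM d1 d3) _; rewrite e1 e2.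
have scaleE (a b : R) : a *: b = a * b by [].
rewrite !scaleE /gpow /gauss_fun (exprS x k) -[(expR \o _) x]/(expR (- x ^+ 2)).
set e := expR _; ring.
Qed.

(** One more power of [x] in [gpow_le] is traded for decay, which makes the boundary terms of the
    integration by parts vanish at infinity. *)
Lemma gpow_le_inv k x : 0 < x -> `|gpow k x| <= (1 + 2 ^+ k.+1 * k.+1`!%:R) / x.
Proof.
move=> x0; rewrite ler_pdivlMr //.
have := gpow_le k.+1 x; rewrite /gpow exprS -mulrA normrM (gtr0_norm x0) mulrC.
move=> /le_trans; apply; apply: ler_piMr.
  by rewrite addr_ge0 // mulr_ge0 // exprn_ge0.
by rewrite -expR0 ler_expR oppr_le0 divr_ge0 // sqr_ge0.
Qed.

Lemma gpowN k x : gpow k (- x) = (-1) ^+ k * gpow k x.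
Proof. by rewrite /gpow /gauss_fun (exprNn x k) sqrrN mulrA. Qed.

Let dgpow k x := k%:R * gpow k.-1 x - 2 * gpow k.+1 x.

Lemma integrable_dgpow k : mu.-integrable setT (EFin \o dgpow k).
Proof.
have h1 := integrableZl measurableT k%:R (integrable_gpow k.-1).
have h2 := integrableZl measurableT 2 (integrable_gpow k.+1).
have := integrableB measurableT h1 h2.
by apply: eq_integrable => // x _ /=; rewrite -!EFinM -EFinB.
Qed.

Lemma continuous_dgpow k : continuous (dgpow k).
Proof.
move=> x; apply: cvgB; (apply: cvgM; [exact: cvg_cst|exact: continuous_gpow]).
Qed.

Lemma measurable_dgpow k : measurable_fun setT (dgpow k).
Proof. by apply: continuous_measurable_fun; exact: continuous_dgpow. Qed.

(** [dgpow k] is the derivative of [gpow k]. The fundamental theorem of calculus on growing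
    symmetric intervals leaves boundary terms tending to zero, and dominated convergence passes to
    the whole line. *)
Lemma integral_dgpow k : (\int[mu]_x (dgpow k x)%:E = 0)%E.
Proof.
pose f_ n x : \bar R := (dgpow k x * \1_(`[- n.+1%:R, n.+1%:R]%classic : set R) x)%:E.
have F n : (\int[mu]_x f_ n x = (gpow k n.+1%:R - gpow k (- n.+1%:R))%:E)%E.
  have ab : - n.+1%:R < n.+1%:R :> R by have := ltr0Sn R n; lra.
  rewrite EFinB -(@continuous_FTC2 _ (dgpow k) (gpow k) _ _ ab); last 3 first.
  - exact: continuous_subspaceT (@continuous_dgpow k).
  - split=> [x _| |].
    + by have [] := is_derive_gpow k x.
    + exact/cvg_at_right_filter/continuous_gpow.
    + exact/cvg_at_left_filter/continuous_gpow.
  - by move=> x _; rewrite derive1E; have [] := is_derive_gpow k x.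
  rewrite [RHS]integral_mkcond /=; apply: eq_integral => x _.
  by rewrite epatch_indic /f_ EFinM.
have lim0 : (fun n => (\int[mu]_x f_ n x)%E) @ \oo --> (0 : \bar R)%E.
  under eq_fun do rewrite F.
  pose c : R := 1 + 2 ^+ k.+1 * k.+1`!%:R.
  apply: cvg_EFin; first exact: nearW.
  apply: norm_cvg0; apply: (@squeeze_cvgr _ _ _ _ (cst 0) (fun n => (2 * c) * harmonic n)).
  - apply: nearW => n /=; rewrite normr_ge0 /= gpowN.
    rewrite -[X in X - _]mul1r -mulrBl normrM.
    have h := gpow_le_inv k (ltr0Sn R n); rewrite -mulrA ler_pM //.
    rewrite (le_trans (ler_normB _ _)) // normr1 normrX normrN1 expr1n.
    by rewrite (_ : 1 + 1 = 2).
  - exact: cvg_cst.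
  - by rewrite -[X in _ --> X](mulr0 (2 * c)); apply: cvgMr; exact: cvg_harmonic.
have mf n : measurable_fun setT (f_ n).
  apply/measurable_EFinP/measurable_funM; first exact: measurable_dgpow.
  exact: measurable_indic.
have md : measurable_fun setT (EFin \o dgpow k).
  by apply/measurable_EFinP; exact: measurable_dgpow.
(* At each point the truncations are constant once the interval contains it. *)
have cf : {ae mu, forall x, setT x -> f_ ^~ x @ \oo --> (EFin \o dgpow k) x}.
  apply: aeW => x _; apply: cvg_near_cst; exists (Num.bound `|x|) => // n /= xn.
  rewrite /f_ indicE mem_set ?mulr1 //= in_itv /= -ler_norml.
  apply: ltW; apply: lt_le_trans (archi_boundP (normr_ge0 x)) _.
  by rewrite ler_nat leqW.
have ig := integrable_abse (integrable_dgpow k).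
have df : {ae mu, forall x n, setT x -> (`|f_ n x| <= (abse \o (EFin \o dgpow k)) x)%E}.
  apply: aeW => x n _ /=; rewrite /f_ lee_fin normrM indicE ler_piMr //.
  by case: (_ \in _); rewrite ?normr1 ?normr0.
have [_ _ limI] := @dominated_convergence _ _ _ mu setT measurableT f_ _ _ mf md cf ig df.
exact: (cvg_unique _ limI lim0).
Qed.
End GaussianMoments.

(** * Integrals of complex-valued functions *)

Section ProductIntegral.
Context d1 d2 (T1 : measurableType d1) (T2 : measurableType d2) (R : realType).
Variables (m1 : {sigma_finite_measure set T1 -> \bar R})
          (m2 : {sigma_finite_measure set T2 -> \bar R}).
Variables (f : T1 -> R) (g : T2 -> R).
Hypotheses (intf : m1.-integrable setT (EFin \o f))
           (intg : m2.-integrable setT (EFin \o g)).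

Let h (p : T1 * T2) : \bar R := (f p.1 * g p.2)%:E.

Lemma integrable_prod : (m1 \x m2)%E.-integrable setT h.
Proof.
have [/measurable_EFinP mf fi] := integrableP _ _ _ intf.
have [/measurable_EFinP mg gi] := integrableP _ _ _ intg.
have mh : measurable_fun setT h.
  apply/measurable_EFinP/measurable_funM.
    exact: measurableT_comp.
  exact: measurableT_comp.
apply/(integrable12ltyP _ _ mh).
rewrite (_ : (fun x => _) = (fun x => `|(f x)%:E| * \int[m2]_y `|(g y)%:E|)%E); last first.
  apply/funext => x; rewrite -ge0_integralZl //; first last.
  - by apply/measurableT_comp => //; exact/measurable_EFinP.
  by apply: eq_integral => y _; rewrite /h EFinM abseM.
rewrite ge0_integralZr //; first last.
- exact: integral_ge0.
- by apply/measurableT_comp => //; exact/measurable_EFinP.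
apply: lte_mul_pinfty => //; first exact: integral_ge0.
by rewrite ge0_fin_numE // integral_ge0.
Qed.

Lemma integral_prod : (\int[(m1 \x m2)%E]_p h p =
  \int[m1]_x (f x)%:E * \int[m2]_y (g y)%:E)%E.
Proof.
rewrite -(integral12_prod_meas1 integrable_prod).
have gf : (\int[m2]_y (g y)%:E)%E \is a fin_num by exact: integrable_fin_num.
rewrite -(fineK gf) -integralZr //; apply: eq_integral => x _.
by rewrite fineK // /fubini_F -integralZl.
Qed.

End ProductIntegral.

Section ComplexIntegral.
Context d (T : measurableType d) (R : realType).
Variable mu : {measure set T -> \bar R}.

(** A relation rather than a function, so that integrability travels with the value and [cint] fits
    [linear_expectation]. *)
Definition cint (f : T -> R[i]) (v : R[i]) : Prop :=
  [/\ mu.-integrable setT (fun x => (complex.Re (f x))%:E),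
      mu.-integrable setT (fun x => (complex.Im (f x))%:E),
      (\int[mu]_x (complex.Re (f x))%:E = (complex.Re v)%:E)%E
    & (\int[mu]_x (complex.Im (f x))%:E = (complex.Im v)%:E)%E].

Lemma linear_cint : linear_expectation cint.
Proof.
(* Both the real and the imaginary part of [a * f + g] are real combinations of three functions, the
   last with coefficient 1. *)
have lin2 (a b : R) (f g k : T -> R) : mu.-integrable setT (EFin \o f) ->
    mu.-integrable setT (EFin \o g) -> mu.-integrable setT (EFin \o k) ->
    let F := fun x => (a * f x + b * g x + k x)%:E in
    mu.-integrable setT F /\ (\int[mu]_x F x = a%:E * \int[mu]_x (f x)%:E +
      b%:E * \int[mu]_x (g x)%:E + \int[mu]_x (k x)%:E)%E.
  move=> fi gi ki F.
  have -> : F = (fun x => a%:E * (f x)%:E + b%:E * (g x)%:E + (k x)%:E)%E.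
    by apply/funext => x; rewrite /F !EFinD !EFinM.
  have i1 := integrableZl measurableT a fi; have i2 := integrableZl measurableT b gi.
  have i3 := integrableD measurableT i1 i2; split.
    have := integrableD measurableT i3 ki.
    exact: eq_integrable.
  rewrite (integralD measurableT i3 ki) (integralD measurableT i1 i2).
  by rewrite !integralZl.
split.
- by move=> f g v fg; rewrite (_ : f = g) //; exact/funext.
- move=> [a b] f g u v [fR fI fRE fIE] [gR gI gRE gIE].
  have [i1 e1] := lin2 a (- b) _ _ _ fR fI gR.
  have [i2 e2] := lin2 a b _ _ _ fI fR gI.
  rewrite fRE fIE gRE in e1; rewrite fRE fIE gIE in e2.
  have ReE x : complex.Re ((a +i* b) * f x + g x) =
    a * complex.Re (f x) + - b * complex.Im (f x) + complex.Re (g x).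
    by case: (f x) (g x) => [? ?] [? ?] /=; rewrite mulNr.
  have ImE x : complex.Im ((a +i* b) * f x + g x) =
    a * complex.Im (f x) + b * complex.Re (f x) + complex.Im (g x).
    by case: (f x) (g x) => [? ?] [? ?] /=; rewrite [b * _]mulrC.
  split.
  + by under eq_fun do rewrite ReE.
  + by under eq_fun do rewrite ImE.
  + under eq_integral do rewrite ReE.
    rewrite e1; case: u v {fRE fIE gRE gIE e1 e2} => [? ?] [? ?] /=.
    by rewrite -!EFinM -!EFinD mulNr.
  + under eq_integral do rewrite ImE.
    rewrite e2; case: u v {fRE fIE gRE gIE e1 e2} => [? ?] [? ?] /=.
    by rewrite -!EFinM -!EFinD [b * _]mulrC.
- by split; rewrite /= ?integral0 //; exact: integrable0.
Qed.

Lemma cint_real (f : T -> R) (v : R) : mu.-integrable setT (EFin \o f) ->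
  (\int[mu]_x (f x)%:E = v%:E)%E -> cint (fun x => (f x)%:C) v%:C.
Proof. by move=> fi fv; split=> //=; rewrite ?integral0 //; exact: integrable0. Qed.

End ComplexIntegral.

(* A copy of [m1 \x m2]: the library's sigma-finite instance for products is
   shadowed by the one for products of subprobabilities, so that products cannot be iterated. *)
Section SigmaFiniteProduct.
Context d1 d2 (T1 : measurableType d1) (T2 : measurableType d2) (R : realType).
Variables (m1 : {sigma_finite_measure set T1 -> \bar R})
          (m2 : {sigma_finite_measure set T2 -> \bar R}).

Definition sprod (A : set (T1 * T2)) : \bar R := (m1 \x m2)%E A.

HB.instance Definition _ := Measure.copy sprod (m1 \x m2)%E.

Lemma sigma_finite_sprod : sigma_finite setT sprod.
Proof.
exact: isSigmaFinite.sigma_finiteT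
  (lebesgue_integral_fubini.measure_function_Measure_isSigmaFinite__to__measure_function_isSigmaFinite m1 m2).
Qed.

HB.instance Definition _ := Measure_isSigmaFinite.Build _ _ _ sprod sigma_finite_sprod.

End SigmaFiniteProduct.

Lemma cint_prod d1 d2 (T1 : measurableType d1) (T2 : measurableType d2) (R : realType)
    (m1 : {sigma_finite_measure set T1 -> \bar R})
    (m2 : {sigma_finite_measure set T2 -> \bar R}) (f : T1 -> R[i]) (g : T2 -> R[i]) u v :
  cint m1 f u -> cint m2 g v ->
  cint (sprod m1 m2) (fun p => f p.1 * g p.2) (u * v).
Proof.
move=> [fR fI fRE fIE] [gR gI gRE gIE].
have [iRR iII] := (integrable_prod fR gR, integrable_prod fI gI).
have [iRI iIR] := (integrable_prod fR gI, integrable_prod fI gR).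
have ReE (p : T1 * T2) : (complex.Re (f p.1 * g p.2))%:E =
    ((complex.Re (f p.1) * complex.Re (g p.2))%:E -
     (complex.Im (f p.1) * complex.Im (g p.2))%:E)%E.
  by case: (f p.1) (g p.2) => [? ?] [? ?].
have ImE (p : T1 * T2) : (complex.Im (f p.1 * g p.2))%:E =
    ((complex.Re (f p.1) * complex.Im (g p.2))%:E +
     (complex.Im (f p.1) * complex.Re (g p.2))%:E)%E.
  by case: (f p.1) (g p.2) => [? ?] [? ?].
have prodE (F : T1 -> R) (G : T2 -> R) a b :
    m1.-integrable setT (EFin \o F) -> m2.-integrable setT (EFin \o G) ->
    (\int[m1]_x (F x)%:E = a%:E)%E -> (\int[m2]_x (G x)%:E = b%:E)%E ->
    (\int[(m1 \x m2)%E]_p (F p.1 * G p.2)%:E = (a * b)%:E)%E.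
  by move=> iF iG Fa Gb; apply: etrans (integral_prod iF iG) _; rewrite Fa Gb.
split.
- under eq_fun do rewrite ReE; have := integrableB measurableT iRR iII; exact: eq_integrable.
- under eq_fun do rewrite ImE; have := integrableD measurableT iRI iIR; exact: eq_integrable.
- under eq_integral do rewrite ReE.
  rewrite (integralB measurableT iRR iII).
  rewrite (prodE _ _ _ _ fR gR fRE gRE) (prodE _ _ _ _ fI gI fIE gIE).
  by case: u v {fRE gRE fIE gIE} => [? ?] [? ?].
- under eq_integral do rewrite ImE.
  rewrite (integralD measurableT iRI iIR).
  rewrite (prodE _ _ _ _ fR gI fRE gIE) (prodE _ _ _ _ fI gR fIE gRE).
  by case: u v {fRE gRE fIE gIE} => [? ?] [? ?].
Qed.

(** * Moments of the standard complex Gaussian *)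

Section ComplexGaussian.
Variable R : realType.
Local Notation mu := (@lebesgue_measure R).

Definition gmom k : R[i] := (\int[mu]_x gpow k x)%R%:C.

Lemma cint_gpow k : cint mu (fun x => (gpow k x)%:C) (gmom k).
Proof.
apply: cint_real; first exact: integrable_gpow.
by rewrite /Rintegral fineK //; apply: integrable_fin_num => //; exact: integrable_gpow.
Qed.

Lemma gmom0 : gmom 0 ^+ 2 = pi%:C.
Proof.
rewrite /gmom /Rintegral -rmorphXn /=.
under eq_integral do rewrite /gpow expr0 mul1r.
by rewrite integralT_gauss /= sqr_sqrtr // pi_ge0.
Qed.

Lemma gmomS k : 2 * gmom k.+1 = k%:R * gmom k.-1.
Proof.
have e := integral_dgpow R k.
have [i1 i2] := (integrable_gpow R k.-1, integrable_gpow R k.+1).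
apply/eqP; rewrite eq_sym -subr_eq0 /gmom -!(rmorph_nat (real_complex R)) -!rmorphM -rmorphB /=.
rewrite -!RintegralZl // -RintegralB //; first last.
- by have := integrableZl measurableT 2 i2; exact: eq_integrable.
- by have := integrableZl measurableT k%:R i1; exact: eq_integrable.
by rewrite /Rintegral e.
Qed.

(** Identifies the formal functional [mom2] with integration over the plane, monomial by monomial;
    the outer variable is evaluated at [p.2], the inner one at [p.1]. *)
Lemma cint_poly2 (P : {poly {poly R[i]}}) :
  cint (sprod mu mu)
    (fun p => (gauss_fun p.1 * gauss_fun p.2)%:C * P.[(p.2%:C)%:P].[p.1%:C]) (mom2 gmom P).
Proof.
have linE := linear_cint (sprod mu mu).
have -> : mom2 gmom P =
    \sum_(i < size P) \sum_(j < size P`_i) P`_i`_j * (gmom j * gmom i).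
  rewrite /mom2 (@mom1_wide _ _ (size P)) ?size_poly //; apply: eq_bigr => i _.
  by rewrite coef_map /= /mom1 mulr_suml; apply: eq_bigr => j _; rewrite mulrA.
have h i j := cint_prod (cint_gpow j) (cint_gpow i).
apply: (expect_ext linE _ (expect_sum linE (fun i : 'I_(size P) =>
  expect_sum linE (fun j : 'I_(size P`_i) => expectZ linE P`_i`_j (h i j))))) => p.
rewrite (horner_coef P) horner_sum mulr_sumr; apply: eq_bigr => i _.
rewrite -polyC_exp hornerM hornerC horner_coef mulr_suml mulr_sumr.
apply: eq_bigr => j _; rewrite /gpow !rmorphM !rmorphXn /=; ring.
Qed.

Definition cgauss (p : R2 R) : R[i] := (pi^-1 * (gauss_fun p.1 * gauss_fun p.2))%:C.

Lemma horner_zlin (c : R[i]) (x y : R) : (zlin c).[(y%:C)%:P].[x%:C] = x%:C + c * y%:C.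
Proof. by rewrite /zlin !hornerE. Qed.

Lemma horner_zlin_pow a b (p : R2 R) :
  (zlin (0 +i* 1) ^+ a * zlin (- (0 +i* 1)) ^+ b).[(p.2%:C)%:P].[p.1%:C] =
  cpx p ^+ a * conjc (cpx p) ^+ b.
Proof.
have powE (P Q : {poly {poly R[i]}}) x y :
    (P ^+ a * Q ^+ b).[y].[x] = P.[y].[x] ^+ a * Q.[y].[x] ^+ b.
  by rewrite !(hornerM, horner_exp).
apply: etrans (powE _ _ _ _) _; congr (_ ^+ _ * _ ^+ _).
  apply: etrans (horner_zlin _ _ _) _; case: p => x y.
  by apply/eqP; rewrite eq_complex /=; apply/andP; split; apply/eqP; ring.
apply: etrans (horner_zlin _ _ _) _; case: p => x y.
by apply/eqP; rewrite eq_complex /=; apply/andP; split; apply/eqP; ring.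
Qed.

Lemma cint_cgauss a b : cint (sprod mu mu)
  (fun p => cgauss p * (cpx p ^+ a * conjc (cpx p) ^+ b)) (wick _ a b).
Proof.
have ii : (0 +i* 1 : R[i]) * (0 +i* 1) = -1.
  by apply/eqP; rewrite eq_complex /=; apply/andP; split; apply/eqP; ring.
have linE := linear_cint (sprod mu mu).
have := cint_poly2 (zlin (0 +i* 1) ^+ a * zlin (- (0 +i* 1)) ^+ b).
(* The total mass [gmom 0 ^+ 2 = pi] cancels the normalisation of [cgauss]. *)
rewrite (mom2_zlin_pow gmomS) // gmom0 => /(expectZ linE (pi^-1)%:C).
rewrite mulrCA -rmorphM /= mulVf ?gt_eqF ?pi_gt0 // mulr1.
apply: expect_ext => // p.
have -> : cgauss p = (pi^-1)%:C * (gauss_fun p.1 * gauss_fun p.2)%:C by exact: rmorphM.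
rewrite -[RHS]mulrA; congr (_ * (_ * _)).
exact: horner_zlin_pow.
Qed.

End ComplexGaussian.

(** * The Gaussian measure on 2x2 complex matrices *)

Section GaussianMatrix.
Variable R : realType.
Implicit Types x : R8 R.
Local Notation mu := (@lebesgue_measure R).
Local Notation mu4 := (sprod (sprod mu mu) (sprod mu mu)).
Local Notation mu8 := (sprod mu4 mu4).

Lemma gauss_densityE x : (gauss_density x)%:C =
  cgauss x.1.1 * cgauss x.1.2 * (cgauss x.2.1 * cgauss x.2.2).
Proof.
rewrite /cgauss -!rmorphM /=; congr (_%:C).
have trE : complex.Re (\tr (conjtmx (mat_of_R8 x) *m mat_of_R8 x)) =
  x.1.1.1 ^+ 2 + x.1.1.2 ^+ 2 + (x.1.2.1 ^+ 2 + x.1.2.2 ^+ 2) +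
  (x.2.1.1 ^+ 2 + x.2.1.2 ^+ 2 + (x.2.2.1 ^+ 2 + x.2.2.2 ^+ 2)).
  rewrite /mxtrace !big_ord_recl !big_ord0 !mxE !big_ord_recl !big_ord0 !mxE /=.
  ring.
rewrite /gauss_density trE /gauss_fun !opprD !expRD.
have := pi_gt0 R; move: (@pi R) => p p0.
by field; rewrite gt_eqF.
Qed.

Lemma cint_moments a a' b b' c c' d d' :
  let H := @mat_of_R8 R in
  cint mu8 (fun x => (gauss_density x)%:C *
      ((H x 0 0 ^+ a * conjtmx (H x) 0 0 ^+ a') * (H x 0 1 ^+ b * conjtmx (H x) 1 0 ^+ b') *
       (H x 1 0 ^+ c * conjtmx (H x) 0 1 ^+ c') * (H x 1 1 ^+ d * conjtmx (H x) 1 1 ^+ d')))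
    (wick _ a a' * wick _ b b' * wick _ c c' * wick _ d d').
Proof.
move=> H.
have := cint_prod (cint_prod (cint_cgauss R a a') (cint_cgauss R b b'))
                  (cint_prod (cint_cgauss R c c') (cint_cgauss R d d')).
rewrite mulrA; apply: (expect_ext (linear_cint _)) => x.
rewrite gauss_densityE /H !mxE /=; ring.
Qed.

Lemma linear_gauss : linear_expectation
  (fun (f : R8 R -> R[i]) v => cint mu8 (fun x => (gauss_density x)%:C * f x) v).
Proof.
have linE := linear_cint mu8; split.
- by move=> f g v fg; apply: expect_ext => // x; rewrite fg.
- move=> a f g u v fu gv; apply: expect_ext (expect_lin linE a fu gv) => // x.
  by rewrite mulrDr mulrCA.
- by apply: expect_ext (expect0 linE) => // x; rewrite mulr0.
Qed.

(** For exponent [m + 1] the two sums are [h_(m+1)] and [h_(m-1)]; the second is empty at [m = 0],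
    so one formula also covers the plain trace. *)
Lemma cint_trace_power (A : 'M[R[i]]_2) (d1 d2 : R) m :
  char_poly A = ('X - (d1%:C)%:P) * ('X - (d2%:C)%:P) ->
  cint mu8 (fun x => (gauss_density x)%:C * trace_power A m.+1 x)
    ((m.+2`!%:R * (\sum_(j < m.+2) d1 ^+ j * d2 ^+ (m.+1 - j))
     - m.+1`!%:R * (d1 * d2 * \sum_(j < m) d1 ^+ j * d2 ^+ (m.-1 - j)))%:C).
Proof.
have sumC n : \sum_(j < n.+1) d1%:C ^+ j * d2%:C ^+ (n - j) =
    (\sum_(j < n.+1) d1 ^+ j * d2 ^+ (n - j))%:C.
  by rewrite rmorph_sum; apply: eq_bigr => j _; rewrite rmorphM !rmorphXn.
move=> cA; case: m => [|m].
  rewrite big_ord0 mulr0 mulr0 subr0 rmorphM rmorph_nat /= -sumC.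
  have [_ <-] := tr_sympow_char_poly 1 cA.
  apply: (expect_ext linear_gauss _ (expect_tr_sympow linear_gauss cint_moments A 1)) => x.
  by rewrite tr_sympow1 /trace_power expr1.
rewrite rmorphB !rmorphM !rmorph_nat /= -!sumC.
have [<- <-] := tr_sympow_char_poly m cA; have [_ <-] := tr_sympow_char_poly m.+2 cA.
exact: (expect_tr_exp2 linear_gauss cint_moments A m).
Qed.

End GaussianMatrix.

(** * Closed forms for distinct and for equal eigenvalues *)

Lemma schur_value_neq (F : fieldType) (d1 d2 : F) m : d1 != d2 ->
  m.+2`!%:R * (\sum_(j < m.+2) d1 ^+ j * d2 ^+ (m.+1 - j))
     - m.+1`!%:R * (d1 * d2 * \sum_(j < m) d1 ^+ j * d2 ^+ (m.-1 - j)) =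
  m.+1`!%:R * (m.+2%:R * (d1 ^+ m.+2 - d2 ^+ m.+2) / (d1 - d2)
                  + (d1 * d2 ^+ m.+1 - d2 * d1 ^+ m.+1) / (d1 - d2)).
Proof.
move=> d12; have d0 : d1 - d2 != 0 by rewrite subr_eq0.
have geom n : \sum_(j < n) d1 ^+ j * d2 ^+ (n.-1 - j) = (d1 ^+ n - d2 ^+ n) / (d1 - d2).
  apply: (mulIf d0); rewrite divfK // mulrC -opprB mulNr -[RHS]opprB; congr (- _).
  by rewrite subrXX; congr (_ * _); apply: eq_bigr => j _; rewrite mulrC.
rewrite (geom m.+2) (geom m) (factS m.+1) natrM !exprS.
by field.
Qed.

Lemma schur_value_eq (F : comNzRingType) (d : F) m :
  m.+2`!%:R * (\sum_(j < m.+2) d ^+ j * d ^+ (m.+1 - j))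
     - m.+1`!%:R * (d * d * \sum_(j < m) d ^+ j * d ^+ (m.-1 - j)) =
  m.+1`!%:R * (m.+1 ^ 2 + m.+1 + 2)%N%:R * d ^+ m.+1.
Proof.
have geom n : \sum_(j < n.+1) d ^+ j * d ^+ (n - j) = n.+1%:R * d ^+ n.
  under eq_bigr => j _ do rewrite -exprD subnKC -1?ltnS //.
  by rewrite sumr_const card_ord mulr_natl.
rewrite geom; case: m => [|m].
  by rewrite big_ord0 !mulr0 subr0 !expr1 mulrA -!natrM.
(* With [n] the exponent of [d], the bracket is [(n+1)^2 - (n-1) = n^2 + n + 2]. *)
rewrite (geom m) (factS m.+2) !natrM !natrD natrX !exprS -!natr1; ring.
Qed.

Theorem theorem3 (R : realType) (A : 'M[R[i]]_2) (d1 d2 : R) (m : nat) :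
  hermitian_mx A ->
  char_poly A = ('X - (d1%:C)%:P) * ('X - (d2%:C)%:P) ->
  (1 <= m)%N ->
  (@leb8 R).-integrable setT
      (fun x => (gauss_density x * complex.Re (trace_power A m x))%:E) /\
  (@leb8 R).-integrable setT
      (fun x => (gauss_density x * complex.Im (trace_power A m x))%:E) /\
  (\int[@leb8 R]_x (gauss_density x * complex.Im (trace_power A m x))%:E = 0)%E /\
  (d1 != d2 ->
     (\int[@leb8 R]_x (gauss_density x * complex.Re (trace_power A m x))%:E)%E =
     ((m`!)%:R * ((m.+1)%:R * (d1 ^+ m.+1 - d2 ^+ m.+1) / (d1 - d2)
                  + (d1 * d2 ^+ m - d2 * d1 ^+ m) / (d1 - d2)))%:E) /\
  (d1 = d2 ->
     (\int[@leb8 R]_x (gauss_density x * complex.Re (trace_power A m x))%:E)%E =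
     ((m`!)%:R * (m ^ 2 + m + 2)%N%:R * d1 ^+ m)%:E).
Proof.
move=> _ cA; case: m => // m _.
(* The iterated [sprod] is convertible to [leb8], and the imaginary integral is zero because the
   value is the image of a real number. *)
have [iRe iIm eRe eIm] := cint_trace_power m cA.
have ReE x : complex.Re ((gauss_density x)%:C * trace_power A m.+1 x) =
    gauss_density x * complex.Re (trace_power A m.+1 x).
  by case: trace_power => u v /=; rewrite mul0r subr0.
have ImE x : complex.Im ((gauss_density x)%:C * trace_power A m.+1 x) =
    gauss_density x * complex.Im (trace_power A m.+1 x).
  by case: trace_power => u v /=; rewrite mul0r addr0.
have eqRe : (fun x => (complex.Re ((gauss_density x)%:C * trace_power A m.+1 x))%:E) =
    (fun x => (gauss_density x * complex.Re (trace_power A m.+1 x))%:E).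
  by apply/funext => x; rewrite ReE.
have eqIm : (fun x => (complex.Im ((gauss_density x)%:C * trace_power A m.+1 x))%:E) =
    (fun x => (gauss_density x * complex.Im (trace_power A m.+1 x))%:E).
  by apply/funext => x; rewrite ImE.
rewrite eqRe in iRe eRe; rewrite eqIm in iIm eIm.
do 3!split=> //; split=> [d12|d12]; rewrite eRe /=; congr EFin.
  exact: schur_value_neq.
by rewrite -d12; exact: schur_value_eq.
Qed.
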